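(* Let $G$ be a weighted DAG and let $S:F\to\bigsqcup_{d\in\mathbb N}\mathrm{int}(\Delta^d)$ be a subdivision of $G$ (with $F\subseteq E(G)$), and let $G_S$ denote the subdivision of $G$ by $S$. Then $$d_I\big((H\circ\mathrm{dFl})(\mathrm{SP}(G)),\,(H\circ\mathrm{dFl})(\mathrm{SP}(G_S))\big)\le\max_{e\in F}w(e),$$ where $w$ is the weighting of $G$.
   Context: All digraphs are simple (no self-loops). A weighted digraph is $G=(V,E,w)$ with $(V,E)$ a digraph and $w:E\to(0,\infty)$. A path $p:s_0\leadsto t_k$ is a (non-empty) sequence of edges $e_i=(s_i,t_i)$, $0\le i\le k$, with $s_{i+1}=t_i$; its length is $\ell(p)=\sum_iw(e_i)$. $G$ is a DAG if whenever there is a path $v_0\leadsto v_1$ there is no path $v_1\leadsto v_0$. The shortest-path filtration $\mathrm{SP}(G)$ is the family of digraphs $\mathrm{SP}(G)_t$, $t\in\mathbb R$, on $V(G)$, with an edge $(i,j)$, $i\neq j$, iff there is a path $i\leadsto j$ of length $\le t$; with inclusions it is a functor from the poset $(\mathbb R,\le)$ to digraphs. A subdivision is a map $S:F\to\bigsqcup_{d\in\mathbb N}\mathrm{int}(\Delta^d)$ from a subset $F\subseteq E(G)$ to the disjoint union of interiors of standard simplices. For $e\in F$ let $d(e)$ be such that $S(e)\in\mathrm{int}(\Delta^{d(e)})$, with components $S(e)_0,\dots,S(e)_{d(e)}$ (positive, summing to $1$). The subdivision of $G$ by $S$ is the weighted digraph $G_S$ with vertices $V(G)\sqcup\bigsqcup_{e\in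 F}\{v_{e,1},\dots,v_{e,d(e)}\}$, edges $(E(G)\setminus F)\sqcup\bigsqcup_{e\in F}\{\tau_{e,0},\dots,\tau_{e,d(e)}\}$ where $\tau_{e,i}=(v_{e,i},v_{e,i+1})$, with $v_{e,0}$ and $v_{e,d(e)+1}$ the source and target of $e$, and weights $w(\tau)$ for $\tau\in E(G)\setminus F$ and $S(e)_i\cdot w(e)$ for $\tau_{e,i}$. Fix a field $\mathbb F$. A directed $k$-clique is a $k$-tuple $v_0\dots v_{k-1}$ of distinct vertices with $v_i\to v_j$ whenever $i<j$. The directed flag complex $\mathrm{dFl}(G)$ has chain complex with basis in degree $k$ the directed $(k+1)$-cliques and $\partial(v_0\dots v_k)=\sum_i(-1)^iv_0\dots\hat{v_i}\dots v_k$ ($\partial_0=0$); $(H\circ\mathrm{dFl})(G)$ is its homology in all degrees, a graded $\mathbb F$-vector space, functorial for inclusions of digraphs. Applying this to $\mathrm{SP}(G)$ at each $t$ gives a persistent graded vector space, i.e. a functor from $(\mathbb R,\le)$ to graded vector spaces. For functors $M,N:(\mathbb R,\le)\to\mathcal C$ and $\delta\ge0$, let $M^\delta(t)=M(t+\delta)$, and let $T_M^\delta:M\Rightarrow M^\delta$ have components $M(t\le t+\delta)$. $M,N$ are $\delta$-interleaved if there are natural transformations $f:M\Rightarrow N^\delta$, $g:N\Rightarrow M^\delta$ with $g^\delta\circ f=T_M^{2\delta}$ and $f^\delta\circ g=T_N^{2\delta}$. $d_I(M,N)=\inf\{\delta\ge0:M,N\text{ are }\delta\text{-interleaved}\}\in[0,\infty]$.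 The maximum over $F$ is assumed to exist (read as $0$ if $F=\emptyset$).
   Formalization: The digraph SP(G)_t is taken to be empty for t<0, rather than having vertex set V(G) for all real t; with all vertices present at t<0 the bound fails (a single edge subdivided once gives d_I = ∞). *)

(* Defs.v *)
From HB Require Import structures.
From mathcomp Require Import all_boot all_order all_algebra.
From mathcomp Require Import zify finmap monalg.
From mathcomp Require Import all_classical all_reals ereal.

Set Implicit Arguments.
Unset Strict Implicit.
Unset Printing Implicit Defensive.

Import Order.TTheory GRing.Theory Num.Theory.

Local Open Scope ring_scope.

(* {malg K[T]} is the free K-module on the set T, with basis << t >>. *)
Section LinearExtension.
Variables (K : fieldType) (T : choiceType) (V : lmodType K) (h : T -> V).

Definition lin_ext (c : {malg K[T]}) : V := \sum_(t <- msupp c) c@_t *: h t.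

Lemma lin_extw (d : {fset T}) c :
  {subset msupp c <= d} -> lin_ext c = \sum_(t <- d) c@_t *: h t.
Proof.
move=> sub; rewrite /lin_ext [RHS](bigID (fun t => t \in msupp c)) /=.
rewrite [X in _ + X]big1 ?addr0; last first.
  by move=> t /mcoeff_outdom ->; rewrite scale0r.
rewrite -[RHS]big_filter; apply: perm_big; apply: uniq_perm => //.
  by rewrite filter_uniq.
by move=> t; rewrite mem_filter; case: (boolP (t \in msupp c)) => //= /sub ->.
Qed.

Lemma lin_ext_is_linear : linear lin_ext.
Proof.
move=> a x y.
pose d := (msupp x `|` msupp y `|` msupp (a *: x + y))%fset.
have subx : {subset msupp x <= d} by move=> t tx; rewrite !inE tx.
have suby : {subset msupp y <= d} by move=> t ty; rewrite !inE ty orbT.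
have subz : {subset msupp (a *: x + y) <= d}.
  by move=> t tz; rewrite !inE tz !orbT.
rewrite (lin_extw subx) (lin_extw suby) (lin_extw subz).
rewrite scaler_sumr -big_split /=; apply: eq_bigr => t _.
by rewrite mcoeffD mcoeffZ scalerDl scalerA.
Qed.

HB.instance Definition _ :=
  GRing.isLinear.Build K {malg K[T]} V *:%R lin_ext lin_ext_is_linear.

Lemma lin_extU t : lin_ext << t >> = h t.
Proof. by rewrite /lin_ext msuppU oner_eq0 big_seq_fset1 mcoeffUU scale1r. Qed.

End LinearExtension.

Lemma malg_linear_eq (K : fieldType) (T : choiceType) (V : lmodType K)
    (f g : {linear {malg K[T]} -> V}) :
  (forall t, f << t >> = g << t >>) -> f =1 g.
Proof.
move=> fg c; rewrite [c]monalgE !linear_sum; apply: eq_bigr => t _.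
have -> : << c@_t *g t >> = c@_t *: << t >> :> {malg K[T]}.
  by apply/malgP => k; rewrite mcoeffZ !mcoeffU mulr_natr.
by rewrite !linearZZ fg.
Qed.

(* Quotient of a K-module by a submodule: the library only provides the
   additive group structure on {quot I}. *)
Section QuotientModule.
Variables (K : fieldType) (V : lmodType K) (I : submodClosed V).

Definition mem_submod : {pred V} := fun x => x \in I.

HB.instance Definition _ := GRing.isZmodClosed.Build V mem_submod
  (GRing.submod_closedB (submodClosedP I)).

Definition quot_module := Quotient.quot mem_submod.
Local Notation Q := quot_module.

HB.instance Definition _ := GRing.Zmodule.on Q.

Definition quot_pi (x : V) : Q := (\pi_(Quotient.quot mem_submod) x)%qT.

Definition quot_repr (q : Q) : V := repr (q : Quotient.quot mem_submod).

Definition quot_scale (a : K) (q : Q) : Q := quot_pi (a *: quot_repr q).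

Lemma quot_piP x y : reflect (quot_pi x = quot_pi y) (x - y \in I).
Proof. by rewrite /quot_pi (Quotient.idealrBE mem_submod); exact: eqP. Qed.

Lemma quot_piK q : quot_pi (quot_repr q) = q.
Proof. exact: reprK. Qed.

Lemma quot_pi_zmod_morphism : zmod_morphism quot_pi.
Proof. by move=> x y; rewrite /quot_pi raddfB. Qed.

HB.instance Definition _ :=
  GRing.isZmodMorphism.Build V Q quot_pi quot_pi_zmod_morphism.

Lemma quot_scale_pi a x : quot_scale a (quot_pi x) = quot_pi (a *: x).
Proof.
by apply/quot_piP; rewrite -scalerBr rpredZ//; apply/quot_piP; rewrite quot_piK.
Qed.

Fact quot_scaleA a b q : quot_scale a (quot_scale b q) = quot_scale (a * b) q.
Proof. by rewrite -[q]quot_piK !quot_scale_pi scalerA. Qed.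

Fact quot_scale1 : left_id 1 quot_scale.
Proof. by move=> q; rewrite -[q]quot_piK quot_scale_pi scale1r. Qed.

Fact quot_scaleDr : right_distributive quot_scale +%R.
Proof.
move=> a p q; rewrite -[p]quot_piK -[q]quot_piK -raddfD !quot_scale_pi.
by rewrite scalerDr raddfD.
Qed.

Fact quot_scaleDl q : {morph quot_scale^~ q : a b / a + b}.
Proof.
by move=> a b; rewrite -[q]quot_piK !quot_scale_pi scalerDl raddfD.
Qed.

HB.instance Definition _ := GRing.Zmodule_isLmodule.Build K Q
  quot_scaleA quot_scale1 quot_scaleDr quot_scaleDl.

Fact quot_pi_scalable : scalable quot_pi.
Proof. by move=> a x; rewrite -quot_scale_pi. Qed.

HB.instance Definition _ :=
  GRing.isScalable.Build K V Q *:%R quot_pi quot_pi_scalable.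

End QuotientModule.

(* bdry k is the boundary operator from degree k.+1 to degree k; the one out
   of degree 0 is 0. *)
Record chain_complex (K : fieldType) := ChainComplex {
  chain :> nat -> lmodType K;
  bdry : forall k, {linear chain k.+1 -> chain k};
  bdryK : forall k c, bdry k (bdry k.+1 c) = 0 }.

Record chain_map (K : fieldType) (C D : chain_complex K) := ChainMap {
  chain_fun :> forall k, {linear C k -> D k};
  chain_funE : forall k c, chain_fun k (bdry C k c) = bdry D k (chain_fun k.+1 c) }.

Section Homology.
Variables (K : fieldType) (C : chain_complex K).

Definition cycles k : {pred C k} :=
  match k return {pred C k} with
  | 0 => predT
  | k'.+1 => [pred c | bdry C k' c == 0]
  end.
Arguments cycles : clear implicits.

Fact cycles_submod_closed k : submod_closed (cycles k).
Proof.
case: k => [|k]; split=> //=; first by rewrite inE /= linear0.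
by move=> a x y; rewrite !inE /= linearP => /eqP -> /eqP ->; rewrite scaler0 addr0.
Qed.

HB.instance Definition _ k :=
  GRing.isSubmodClosed.Build K (C k) (cycles k) (cycles_submod_closed k).

Record cycle k := Cycle { cycle_val : C k; cycleP : cycle_val \in cycles k }.

HB.instance Definition _ k := [isSub for @cycle_val k].
HB.instance Definition _ k := [Choice of cycle k by <:].
HB.instance Definition _ k := [SubChoice_isSubLmodule of cycle k by <:].

Definition boundaries k : {pred cycle k} :=
  [pred z | `[< exists c, val z = bdry C k c >]].
Arguments boundaries : clear implicits.

Fact boundaries_submod_closed k : submod_closed (boundaries k).
Proof.
split=> [|a x y]; first by apply/asboolP; exists 0; rewrite !linear0.
move=> /asboolP[c xc] /asboolP[d yd]; apply/asboolP.
by exists (a *: c + d); rewrite !linearP /= xc yd.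
Qed.

HB.instance Definition _ k :=
  GRing.isSubmodClosed.Build K (cycle k) (boundaries k) (boundaries_submod_closed k).

Definition homology k : lmodType K := quot_module (boundaries k).

End Homology.
Arguments cycles {K} C k _.
Arguments boundaries {K} C k _.

Section HomologyMap.
Variables (K : fieldType) (C D : chain_complex K) (f : chain_map C D).

Fact cycle_map_subproof k (z : cycle C k) : f k (val z) \in cycles D k.
Proof.
case: k z => [|k] [c] //=; rewrite !inE /= => /eqP c0.
by rewrite -chain_funE c0 linear0.
Qed.

Definition cycle_map k (z : cycle C k) : cycle D k :=
  Cycle (cycle_map_subproof z).

Fact cycle_map_is_linear k : linear (@cycle_map k).
Proof.
move=> a x y; apply: val_inj.
by rewrite [RHS](linearP (val : cycle D k -> D k)) /= linearP.
Qed.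

HB.instance Definition _ k := GRing.isLinear.Build K (cycle C k) (cycle D k)
  *:%R (@cycle_map k) (@cycle_map_is_linear k).

Definition homology_map k (q : homology C k) : homology D k :=
  quot_pi (boundaries D k) (cycle_map (quot_repr q)).

Lemma homology_map_pi k (z : cycle C k) :
  homology_map (quot_pi (boundaries C k) z) =
  quot_pi (boundaries D k) (cycle_map z).
Proof.
apply/quot_piP; rewrite -linearB /=.
have /quot_piP : quot_pi (boundaries C k) (quot_repr (quot_pi (boundaries C k) z))
    = quot_pi (boundaries C k) z by rewrite quot_piK.
move=> /asboolP[c zc]; apply/asboolP; exists (f k.+1 c).
by rewrite -chain_funE -zc.
Qed.

Fact homology_map_is_linear k : linear (@homology_map k).
Proof.
move=> a x y; rewrite -[x]quot_piK -[y]quot_piK -linearP !homology_map_pi.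
by rewrite !linearP.
Qed.

HB.instance Definition _ k := GRing.isLinear.Build K (homology C k)
  (homology D k) *:%R (@homology_map k) (@homology_map_is_linear k).

End HomologyMap.

Lemma homology_map_id (K : fieldType) (C : chain_complex K) (f : chain_map C C) :
  (forall k c, f k c = c) -> forall k q, homology_map f (k := k) q = q.
Proof.
move=> fid k q; rewrite -[q]quot_piK homology_map_pi; congr quot_pi.
by apply: val_inj; rewrite /= fid.
Qed.

Lemma homology_map_comp (K : fieldType) (C D E : chain_complex K)
    (f : chain_map C D) (g : chain_map D E) (h : chain_map C E) :
  (forall k c, g k (f k c) = h k c) ->
  forall k q, homology_map g (homology_map f (k := k) q) = homology_map h q.
Proof.
move=> gf k q; rewrite -[q]quot_piK !homology_map_pi; congr quot_pi.
by apply: val_inj; rewrite /= gf.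
Qed.

(* Digraphs whose vertices lie in an ambient set V, so that inclusions of
   digraphs are inclusions of vertex and edge sets. *)
Record digraph (V : choiceType) := Digraph {
  verts : {pred V};
  adj : rel V;
  adj_verts : forall x y, adj x y -> (x \in verts) && (y \in verts);
  adjxx : irreflexive adj }.

Definition subdigraph (V : choiceType) (G H : digraph V) : Prop :=
  {subset verts G <= verts H} /\ subrel (adj G) (adj H).

Section Clique.
Variables (V : choiceType) (G : digraph V).

Definition directed_clique n (s : n.-tuple V) : bool :=
  [&& uniq s, all (fun v => v \in verts G) s &
  [forall i : 'I_n, forall j : 'I_n, (i < j)%N ==> adj G (tnth s i) (tnth s j)]].

Definition clique n := {s : n.-tuple V | directed_clique s}.

HB.instance Definition _ n := Choice.on (clique n).

Definition del_vertex n (s : n.+1.-tuple V) (i : 'I_n.+1) : n.-tuple V :=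
  [tuple tnth s (lift i j) | j < n].

Fact del_vertex_clique n (s : clique n.+1) (i : 'I_n.+1) :
  directed_clique (del_vertex (val s) i).
Proof.
case: s => s /= /and3P[/tuple_uniqP s_inj /allP s_verts /'forall_'forall_implyP adjs].
apply/and3P; split.
- by apply/tuple_uniqP => j k; rewrite !tnth_mktuple => /s_inj; exact: lift_inj.
- by apply/allP => _ /mapP[j _ ->]; apply/s_verts/mem_tnth.
apply/'forall_'forall_implyP => j k jk; rewrite !tnth_mktuple adjs//=.
by rewrite /bump; case: leqP; case: leqP; lia.
Qed.

Definition face n (s : clique n.+1) (i : 'I_n.+1) : clique n :=
  Sub (del_vertex (val s) i) (del_vertex_clique s i).

Lemma face_face n (s : clique n.+2) (i i' : 'I_n.+2) (j j' : 'I_n.+1) :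
  (j < i)%N -> i' = j :> nat -> i = j'.+1 :> nat ->
  face (face s i) j = face (face s i') j'.
Proof.
move=> ji i'j ij'; apply: val_inj; apply: eq_from_tnth => l /=.
rewrite !tnth_mktuple; congr tnth; apply: val_inj => /=.
rewrite /bump i'j ij'; rewrite ij' in ji.
by do ?case: leqP => ? //=; lia.
Qed.

Variable K : fieldType.

Definition flag_bdry n : {linear {malg K[clique n.+2]} -> {malg K[clique n.+1]}} :=
  lin_ext (fun s : clique n.+2 => \sum_(i < n.+2) (-1) ^+ i *: << face s i >>).

Lemma flag_bdryU n s :
  flag_bdry n << s >> = \sum_(i < n.+2) (-1) ^+ i *: << face s i >>.
Proof. exact: lin_extU. Qed.

Fact flag_bdryK n (c : {malg K[clique n.+3]}) :
  flag_bdry n (flag_bdry n.+1 c) = 0.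
Proof.
have -> : flag_bdry n (flag_bdry n.+1 c) = (flag_bdry n \o flag_bdry n.+1) c by [].
rewrite (@malg_linear_eq _ _ _ _ \0%R)//= => s; rewrite flag_bdryU linear_sum /=.
under eq_bigr => i _ do rewrite linearZZ flag_bdryU scaler_sumr.
rewrite pair_big /=.
rewrite (bigID (fun p : 'I_n.+3 * 'I_n.+2 => (p.2 < p.1)%N)) /=.
pose h (p : 'I_n.+3 * 'I_n.+2) : 'I_n.+3 * 'I_n.+2 := (inord p.2, inord p.1.-1).
pose h' (p : 'I_n.+3 * 'I_n.+2) : 'I_n.+3 * 'I_n.+2 := (inord p.2.+1, inord p.1).
rewrite [X in _ + X](reindex_onto h h') /=; last first.
  move=> [i j] /=; rewrite -leqNgt => ij; rewrite /h /h' /=; congr pair;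
  by apply: val_inj; rewrite /= ?inordK//=; have := ltn_ord i; have := ltn_ord j;
    rewrite ?inordK; lia.
rewrite [X in _ + X](eq_bigl (fun p : 'I_n.+3 * 'I_n.+2 => (p.2 < p.1)%N)).
  rewrite -big_split /= big1 // => -[i j] /= ji.
  have i'E : (inord j : 'I_n.+3) = j :> nat by rewrite inordK//; have := ltn_ord j; lia.
  have j'E : (inord i.-1 : 'I_n.+2) = i.-1 :> nat by rewrite inordK//; have := ltn_ord i; lia.
  rewrite (@face_face _ s i (inord j) j (inord i.-1)) ?i'E ?j'E //; last by lia.
  rewrite !scalerA -!exprD -scalerDl; have -> : (i + j = (j + i.-1).+1)%N by lia.
  by rewrite exprS mulN1r addNr scale0r.
move=> [i j] /=; rewrite /h /h' /=.
have i'E : (inord j : 'I_n.+3) = j :> nat by rewrite inordK//; have := ltn_ord j; lia.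
have j'E : (inord i.-1 : 'I_n.+2) = i.-1 :> nat by rewrite inordK//; have := ltn_ord i; lia.
rewrite i'E j'E -leqNgt; apply/andP/idP.
  move=> [ji /eqP[/(congr1 val) /= +  _]].
  rewrite inordK; last by have := ltn_ord i; lia.
  by lia.
move=> ji; split; first by lia.
apply/eqP; congr pair; apply: val_inj; rewrite /= ?inordK; have := ltn_ord i; have := ltn_ord j; lia.
Qed.

Definition dFl : chain_complex K :=
  ChainComplex (chain := fun n => {malg K[clique n.+1]}) flag_bdryK.

End Clique.

Section DirectedFlagMap.
Variables (V : choiceType) (G H : digraph V) (GH : subdigraph G H).
Variable K : fieldType.

Fact clique_incl_subproof n (s : clique G n) : directed_clique H (val s).
Proof.
case: s => s /= /and3P[s_uniq /allP s_verts /'forall_'forall_implyP adjs].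
apply/and3P; split=> //; first by apply/allP => v /s_verts; exact: GH.1.
by apply/'forall_'forall_implyP => i j ij; exact/GH.2/adjs.
Qed.

Definition clique_incl n (s : clique G n) : clique H n :=
  Sub (val s) (clique_incl_subproof s).

Definition dFl_map_fun n : {linear dFl G K n -> dFl H K n} :=
  lin_ext (fun s : clique G n.+1 => << clique_incl s >> : {malg K[clique H n.+1]}).

Lemma dFl_map_funU n s : dFl_map_fun n << s >> = << clique_incl s >>.
Proof. exact: lin_extU. Qed.

Fact dFl_map_funE n c :
  dFl_map_fun n (bdry (dFl G K) n c) = bdry (dFl H K) n (dFl_map_fun n.+1 c).
Proof.
apply: (@malg_linear_eq _ _ _ (dFl_map_fun n \o bdry (dFl G K) n)
  (bdry (dFl H K) n \o dFl_map_fun n.+1)) => s /=.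
rewrite dFl_map_funU !flag_bdryU linear_sum; apply: eq_bigr => i _ /=.
rewrite linearZZ dFl_map_funU; congr (_ *: << _ >>).
exact: val_inj.
Qed.

Definition dFl_map : chain_map (dFl G K) (dFl H K) := ChainMap dFl_map_funE.

End DirectedFlagMap.

Lemma dFl_map_id (V : choiceType) (G : digraph V) (GG : subdigraph G G)
  (K : fieldType) k c : dFl_map GG K k c = c.
Proof.
apply: (@malg_linear_eq _ _ _ (dFl_map GG K k) idfun) => s /=.
by rewrite dFl_map_funU; congr << _ >>; apply: val_inj.
Qed.

Lemma dFl_map_comp (V : choiceType) (G H I : digraph V) (GH : subdigraph G H)
    (HI : subdigraph H I) (GI : subdigraph G I) (K : fieldType) k c :
  dFl_map HI K k (dFl_map GH K k c) = dFl_map GI K k c.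
Proof.
apply: (@malg_linear_eq _ _ _ (dFl_map HI K k \o dFl_map GH K k)
  (dFl_map GI K k)) => s /=.
by rewrite !dFl_map_funU; congr << _ >>; apply: val_inj.
Qed.

(* The edge set is a type whose elements are determined by their endpoints,
   i.e. it is identified with a subset of vertex * vertex off the diagonal. *)
Record wdigraph (R : realType) := WDigraph {
  vertex : choiceType;
  edge : choiceType;
  src : edge -> vertex;
  tgt : edge -> vertex;
  weight : edge -> R;
  src_neq_tgt : forall e, src e != tgt e;
  edge_inj : forall e f, src e = src f -> tgt e = tgt f -> e = f;
  weight_gt0 : forall e, 0 < weight e }.

Section WeightedDigraph.
Variables (R : realType) (G : wdigraph R).

(* A path is a nonempty sequence of edges e :: p. *)
Definition is_path (x y : vertex G) (e : edge G) (p : seq (edge G)) : Prop :=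
  [/\ path (fun e1 e2 => tgt e1 == src e2) e p, src e = x & tgt (last e p) = y].

Definition path_length (e : edge G) (p : seq (edge G)) : R :=
  \sum_(f <- e :: p) weight f.

Definition has_path (x y : vertex G) : Prop := exists e p, is_path x y e p.

Definition is_dag : Prop := forall x y, has_path x y -> ~ has_path y x.

Definition SP_adj (t : R) : rel (vertex G) := fun x y =>
  (x != y) && `[< exists e p, is_path x y e p /\ path_length e p <= t >].

(* The vertices enter the filtration at t = 0. For t < 0 there are no edges
   either, and if all the vertices were already present there, then H_0 would
   be constant on t < 0 of dimension the number of vertices; digraphs with
   different finite numbers of vertices would always be at infinite
   interleaving distance, in particular a finite digraph and any proper
   subdivision of it. *)
Definition SP_verts (t : R) : {pred vertex G} := fun _ => 0 <= t.

Fact SP_adj_verts t x y :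
  SP_adj t x y -> (x \in SP_verts t) && (y \in SP_verts t).
Proof.
case/andP=> _ /asboolP[e [p [_ le_t]]]; apply/andP; split;
  by apply: le_trans le_t; apply: sumr_ge0 => f _; exact/ltW/weight_gt0.
Qed.

Fact SP_adjxx t : irreflexive (SP_adj t).
Proof. by move=> x; rewrite /SP_adj eqxx. Qed.

Definition SP (t : R) : digraph (vertex G) :=
  Digraph (@SP_adj_verts t) (@SP_adjxx t).

Lemma SP_subdigraph (s t : R) : s <= t -> subdigraph (SP s) (SP t).
Proof.
move=> st; split=> [x|x y /andP[xy /asboolP[e [p [pP le_s]]]]].
  by move=> s0; exact: le_trans st.
by apply/andP; split=> //; apply/asboolP; exists e, p; split=> //; exact: le_trans st.
Qed.

End WeightedDigraph.

Definition open_simplex (R : realType) (d : nat) :=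
  {x : {ffun 'I_d.+1 -> R} | [forall i, 0 < x i] && (\sum_i x i == 1)}.

Definition subdivision (R : realType) (G : wdigraph R) (F : set (edge G)) :=
  F -> {d : nat & open_simplex R d}.

Section Subdivide.
Variables (R : realType) (G : wdigraph R) (F : set (edge G)) (S : subdivision F).

Definition sd_dim (e : F) : nat := tag (S e).

Definition sd_coord (e : F) : {ffun 'I_(sd_dim e).+1 -> R} := val (tagged (S e)).

(* The pair (e, j) with j : 'I_(sd_dim e) stands for v_{e, j.+1}. *)
Definition sd_vertex : choiceType := (vertex G + {e : F & 'I_(sd_dim e)})%type.

Definition sd_edge : choiceType :=
  ((~` F)%classic + {e : F & 'I_(sd_dim e).+1})%type.

(* v_{e,i} for 0 <= i <= (sd_dim e).+1 *)
Definition sd_point (e : F) (i : nat) : sd_vertex :=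
  if i is j.+1 then
    if insub j is Some k then inr (existT (fun e : F => 'I_(sd_dim e)) e k)
    else inl (tgt (val e))
  else inl (src (val e)).
Arguments sd_point : simpl never.

Definition sd_src (a : sd_edge) : sd_vertex :=
  match a with
  | inl e => inl (src (val e))
  | inr (existT e i) => sd_point e i
  end.

Definition sd_tgt (a : sd_edge) : sd_vertex :=
  match a with
  | inl e => inl (tgt (val e))
  | inr (existT e i) => sd_point e i.+1
  end.

Definition sd_weight (a : sd_edge) : R :=
  match a with
  | inl e => weight (val e)
  | inr (existT e i) => sd_coord e i * weight (val e)
  end.

Let sd_tag (x : sd_vertex) : option (F * nat) :=
  if x is inr (existT e k) then Some (e, val k) else None.

Let sd_tag_pointS e j :
  sd_tag (sd_point e j.+1) = if (j < sd_dim e)%N then Some (e, j) else None.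
Proof. by rewrite /sd_point; case: insubP => [u -> /= ->|/negPf ->]. Qed.

Let sd_point_outer e j :
  (sd_dim e <= j)%N -> sd_point e j.+1 = inl (tgt (val e)).
Proof. by rewrite leqNgt /sd_point => /negPf lejd; rewrite insubF. Qed.

Fact sd_src_neq_tgt a : sd_src a != sd_tgt a.
Proof.
case: a => [e|[e [i /= ltid]]] /=.
  by apply/eqP => -[] /eqP; exact/negP/src_neq_tgt.
apply/eqP; case: i ltid => [|i] ltid E.
  have := congr1 sd_tag E; rewrite sd_tag_pointS; case: ltnP => // le_d _.
  by move: E; rewrite sd_point_outer//= => -[] /eqP; exact/negP/src_neq_tgt.
have := congr1 sd_tag E; rewrite !sd_tag_pointS -ltnS ltid.
by case: ifP => // _ [] /eqP; rewrite eqn_leq ltnn andbF.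
Qed.

Fact sd_edge_inj a b : sd_src a = sd_src b -> sd_tgt a = sd_tgt b -> a = b.
Proof.
have mixed (e : (~` F)%classic) (f : F) (i : 'I_(sd_dim f).+1) :
    inl (src (val e)) = sd_point f i -> inl (tgt (val e)) = sd_point f i.+1 -> False.
  case: i => -[|i] /= ltid Es Et.
    have := congr1 sd_tag Et; rewrite sd_tag_pointS; case: ltnP => // le_d _.
    move: Et; rewrite sd_point_outer// => -[Et]; case: Es => Es.
    have := set_valP e; have := set_valP f; rewrite /set_val /= => Ff nFe.
    by apply: nFe; rewrite (edge_inj Es Et).
  by have := congr1 sd_tag Es; rewrite sd_tag_pointS -ltnS ltid.
case: a b => [e|[e i]] [f|[f j]] /= Es Et.
- by congr inl; apply: val_inj; case: Es Et => Es [Et]; exact: edge_inj.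
- by case: (mixed _ _ _ Es Et).
- by case: (mixed _ _ _ (esym Es) (esym Et)).
suff [ef ij] : e = f /\ i = j :> nat.
  by case: _ / ef j ij {Es Et} => j ij; congr (inr (existT _ _ _)); apply: val_inj.
case: i Es Et => -[|i] /= ltie; case: j => -[|j] /= ltjf Es Et.
- have := congr1 sd_tag Et; rewrite !sd_tag_pointS.
  case: ltnP => [_|le_e]; case: ltnP => [_|le_f] //; first by case=> ->.
  move=> _.
  move: Et; rewrite !sd_point_outer// => -[Et]; case: Es => Es.
  by split=> //; apply: val_inj; exact: edge_inj.
- by have := congr1 sd_tag Es; rewrite sd_tag_pointS -ltnS ltjf.
- by have := congr1 sd_tag Es; rewrite sd_tag_pointS -ltnS ltie.
- have := congr1 sd_tag Es; rewrite !sd_tag_pointS.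
  by move: (ltie) (ltjf); rewrite !ltnS => -> -> [-> ->].
Qed.

Fact sd_weight_gt0 a : 0 < sd_weight a.
Proof.
case: a => [e|[e i]] /=; rewrite ?mulr_gt0 ?weight_gt0 //.
by have /andP[/forallP + _] := valP (tagged (S e)); exact.
Qed.

Definition subdivide : wdigraph R :=
  WDigraph sd_src_neq_tgt sd_edge_inj sd_weight_gt0.

End Subdivide.

Record persistent_gvs (R : realType) (K : fieldType) := PersistentGvs {
  pers_obj :> R -> nat -> lmodType K;
  pers_map : forall s t, s <= t -> forall k, {linear pers_obj s k -> pers_obj t k};
  pers_map_id : forall t (tt : t <= t) k x, pers_map tt k x = x;
  pers_map_comp : forall r s t (rs : r <= s) (st : s <= t) (rt : r <= t) k x,
    pers_map st k (pers_map rs k x) = pers_map rt k x }.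

Section Interleaving.
Variables (R : realType) (K : fieldType).
Implicit Types M N : persistent_gvs R K.

Section Shift.
Variables (M : persistent_gvs R K) (d : R).

Definition shift_map s t (st : s <= t) :
    forall k, {linear M (s + d) k -> M (t + d) k} :=
  pers_map M (lerD st (lexx d)).

Fact shift_map_id t (tt : t <= t) k x : shift_map tt k x = x.
Proof. exact: pers_map_id. Qed.

Fact shift_map_comp r s t (rs : r <= s) (st : s <= t) (rt : r <= t) k x :
  shift_map st k (shift_map rs k x) = shift_map rt k x.
Proof. exact: pers_map_comp. Qed.

Definition shift : persistent_gvs R K :=
  PersistentGvs (pers_obj := fun t => M (t + d)) shift_map_id shift_map_comp.

End Shift.

Record pers_hom M N := PersHom {
  pers_fun :> forall t k, {linear M t k -> N t k};
  pers_natural : forall s t (st : s <= t) k x,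
    pers_fun t k (pers_map M st k x) = pers_map N st k (pers_fun s k x) }.

(* The codomain of g^d \o f at t is M (t + d + d), so T_M^{2d} appears as the
   structure map of M from t to t + d + d. *)
Definition interleaved M N (d : R) : Prop :=
  exists (f : pers_hom M (shift N d)) (g : pers_hom N (shift M d)),
    (forall t (le_t : t <= t + d + d) k (x : M t k),
       g (t + d) k (f t k x) = pers_map M le_t k x) /\
    (forall t (le_t : t <= t + d + d) k (x : N t k),
       f (t + d) k (g t k x) = pers_map N le_t k x).

Definition interleaving_distance M N : \bar R :=
  ereal_inf [set d%:E | d in [set d : R | 0 <= d /\ interleaved M N d]].

End Interleaving.

Section PersistentHomology.
Variables (R : realType) (K : fieldType) (G : wdigraph R).

Definition HdFl_SP_map s t (st : s <= t) k :
    {linear homology (dFl (SP G s) K) k -> homology (dFl (SP G t) K) k} :=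
  homology_map (dFl_map (SP_subdigraph G st) K) (k := k).

Fact HdFl_SP_map_id t (tt : t <= t) k x : HdFl_SP_map tt k x = x.
Proof. by apply: homology_map_id => n c; exact: dFl_map_id. Qed.

Fact HdFl_SP_map_comp r s t (rs : r <= s) (st : s <= t) (rt : r <= t) k x :
  HdFl_SP_map st k (HdFl_SP_map rs k x) = HdFl_SP_map rt k x.
Proof. by apply: homology_map_comp => n c; exact: dFl_map_comp. Qed.

Definition HdFl_SP : persistent_gvs R K :=
  PersistentGvs HdFl_SP_map_id HdFl_SP_map_comp.

End PersistentHomology.

Definition is_max_weight (R : realType) (G : wdigraph R) (F : set (edge G))
    (m : R) : Prop :=
  (F = set0 /\ m = 0) \/
  ((exists2 e, F e & weight e = m) /\ (forall e, F e -> weight e <= m)).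

(* Main.v *)
From HB Require Import structures.
Require Import Defs.
From mathcomp Require Import all_boot all_order all_algebra.
From mathcomp Require Import zify ring monalg.
From mathcomp Require Import all_classical all_reals ereal.

(** Let [iota] be the inclusion of the vertices of [G] into those of the
    subdivision [G_S], let [pi] be the retraction that sends a subdivision
    point [v_(e,i)] to the target of [e], and let [r v] be the length of the
    part of [e] that lies after [v = v_(e,i)], with [r v = 0] on the vertices
    of [G].  A path of length [l] in [G] becomes a path of the same length in
    [G_S] ([walk_inl]), and a path from [v] to [w] of length [l] in [G_S]
    becomes one from [pi v] to [pi w] of length [l - r v + r w], possibly empty
    ([walk_proj]).  As [0 <= r <= m], both vertex maps lengthen paths by at
    most [m], so they are maps of digraphs from stage [t] of one filtration to
    stage [t + m] of the other, except that [pi] may identify the ends of an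
    edge.

    A vertex map that may collapse edges still acts on directed flag complexes
    by sending the cliques whose image has a repeated vertex to [0].  This is a
    chain map as soon as the target has no pair of opposite edges: then equal
    vertices in the image of a clique can only be adjacent, and the two faces
    that delete one of two equal neighbours cancel ([to_dFl_bdry]).  The
    stages of [SP(G)] and [SP(G_S)] have no opposite edges because [G] is
    acyclic, and with it [G_S] ([subdivide_acyclic]).

    It remains to compare the composites with the structure maps.  The map
    [pi \o iota] is the identity.  Since [w] reaches [pi w] by a path of length
    [r w], an edge from [v] to [w] at stage [t] yields an edge from [v] to
    [pi w] at stage [t + m], unless the two coincide.  So the inclusion and
    [iota \o pi] are contiguous, and contiguous maps induce the same map in
    homology ([contiguous_homology]), by the usual prism operator. *)

Set Implicit Arguments.
Unset Strict Implicit.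
Unset Printing Implicit Defensive.

Import Order.TTheory GRing.Theory Num.Theory.

Local Open Scope ring_scope.

(** * Chains on arbitrary vertex sequences *)

(** The additive part of the inductive step of [chain_prism_homotopy], stated
    apart so that the cancellation happens between variables. *)
Lemma prism_cancel (U : zmodType) (a b c p x y : U) :
  a - (b - c) - (p - x) + (p - (c - y)) = a - (b - (x + y)).
Proof.
rewrite !opprB !addrA subrK [LHS](ACl (1*4*5*3*(2*6)))%AC /=.
by rewrite subrr addr0.
Qed.

(** The free module on all finite sequences of vertices, of every length and
    with repetitions, is the augmented ordered chain complex of the full
    simplex.  Gathering all degrees in one module makes the boundary and the
    prism operator plain recursions on lists, and the homotopy formula an
    induction of a few lines. *)
Section SequenceChains.
Variables (K : fieldType) (V : choiceType).

Definition cone (x : V) :=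
  lin_ext (fun s => << x :: s >> : {malg K[seq V]}).
HB.instance Definition _ (x : V) := GRing.Linear.on (cone x).

Lemma coneU x s : cone x << s >> = << x :: s >>.
Proof. exact: lin_extU. Qed.

(** The alternating sum of faces, in the recursive form
    [d (x s) = s - x (d s)].  The one-vertex sequences have the empty sequence
    as boundary: this is the augmented complex. *)
Fixpoint seq_bdry (s : seq V) : {malg K[seq V]} :=
  if s is x :: s' then << s' >> - cone x (seq_bdry s') else 0.

Definition chain_bdry := lin_ext seq_bdry.
HB.instance Definition _ := GRing.Linear.on chain_bdry.

Lemma chain_bdryU s : chain_bdry << s >> = seq_bdry s.
Proof. exact: lin_extU. Qed.

Lemma chain_bdry_cone x c :
  chain_bdry (cone x c) = c - cone x (chain_bdry c).
Proof.
apply: (@malg_linear_eq _ _ _ (chain_bdry \o cone x)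
  (idfun \- (cone x \o chain_bdry))) => s /=.
by rewrite coneU !chain_bdryU.
Qed.

Lemma seq_bdryE s :
  seq_bdry s = \sum_(i < size s) (-1) ^+ i *: << take i s ++ drop i.+1 s >>.
Proof.
elim: s => [|x s IHs]; first by rewrite big_ord0.
rewrite /= big_ord_recl /= scale1r drop0; congr (_ + _).
rewrite IHs (linear_sum (cone _)) -sumrN; apply: eq_bigr => i _ /=.
by rewrite linearZ /= coneU exprS mulN1r scaleNr.
Qed.

(** The faces that delete one of the two neighbouring copies of [x] cancel, and
    every other face still contains both copies. *)
Lemma seq_bdry_repeat (U : lmodType K) (L : {linear {malg K[seq V]} -> U})
    a x b :
  (forall s, ~~ uniq s -> L << s >> = 0) -> L (seq_bdry (a ++ x :: x :: b)) = 0.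
Proof.
elim: a L => [|y a IHa] L L0 /=.
  rewrite (linearB (cone x)) /= coneU subKr.
  apply: (@malg_linear_eq _ _ _ (L \o (cone x \o cone x)) \0) => s /=.
  by rewrite !coneU L0 //= inE eqxx.
rewrite linearB /= L0; last by rewrite cat_uniq /= inE eqxx !andbF.
have /= -> := IHa (L \o cone y); rewrite ?subr0 // => s s_dup /=.
by rewrite coneU L0 //= negb_and s_dup orbT.
Qed.

End SequenceChains.
Arguments chain_bdry {K V}.
Arguments cone {K V}.

Section SequenceMaps.
Variables (K : fieldType) (V W : choiceType).
Implicit Types f g : V -> W.

Definition chain_push f :=
  lin_ext (fun s => << map f s >> : {malg K[seq W]}).
HB.instance Definition _ f := GRing.Linear.on (chain_push f).

Lemma chain_pushU f s : chain_push f << s >> = << map f s >>.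
Proof. exact: lin_extU. Qed.

Lemma chain_push_cone f x c :
  chain_push f (cone x c) = cone (f x) (chain_push f c).
Proof.
apply: (@malg_linear_eq _ _ _ (chain_push f \o cone x)
  (cone (f x) \o chain_push f)) => s /=.
by rewrite coneU !chain_pushU coneU.
Qed.

Lemma chain_push_bdry f c :
  chain_push f (chain_bdry c) = chain_bdry (chain_push f c).
Proof.
apply: (@malg_linear_eq _ _ _ (chain_push f \o chain_bdry)
  (chain_bdry \o chain_push f)) => s /=.
rewrite chain_pushU !chain_bdryU; elim: s => [|x s IHs] /=; first exact: linear0.
by rewrite (linearB (chain_push f)) /= chain_pushU chain_push_cone IHs.
Qed.

(** The prism operator, i.e. the alternating sum of the sequences
    [f x_0 ... f x_i g x_i ... g x_n] of [seq_prismE], in recursive form. *)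
Fixpoint seq_prism f g (s : seq V) : {malg K[seq W]} :=
  if s is x :: s' then << f x :: map g s >> - cone (f x) (seq_prism f g s')
  else 0.

Definition chain_prism f g := lin_ext (seq_prism f g).
HB.instance Definition _ f g := GRing.Linear.on (chain_prism f g).

Lemma chain_prismU f g s : chain_prism f g << s >> = seq_prism f g s.
Proof. exact: lin_extU. Qed.

Lemma chain_prism_cone f g x c :
  chain_prism f g (cone x c) =
  cone (f x) (cone (g x) (chain_push g c)) - cone (f x) (chain_prism f g c).
Proof.
apply: (@malg_linear_eq _ _ _ (chain_prism f g \o cone x)
  ((cone (f x) \o (cone (g x) \o chain_push g)) \-
   (cone (f x) \o chain_prism f g))) => s /=.
by rewrite coneU !chain_prismU chain_pushU !coneU.
Qed.

Lemma seq_prismE f g s :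
  seq_prism f g s = \sum_(i < size s)
    (-1) ^+ i *: << map f (take i.+1 s) ++ map g (drop i s) >>.
Proof.
elim: s => [|x s IHs]; first by rewrite big_ord0.
rewrite /= big_ord_recl /= take0 scale1r; congr (_ + _).
rewrite IHs (linear_sum (cone _)) -sumrN; apply: eq_bigr => i _ /=.
by rewrite linearZ /= coneU exprS mulN1r scaleNr.
Qed.

(** Support argument: to show that a property defined by a linear equation holds
    for a prism, it is enough to check it on each of its terms. *)
Lemma linear_seq_prism0 (U : lmodType K) (L : {linear {malg K[seq W]} -> U}) f g s :
  (forall i, L << map f (take i.+1 s) ++ map g (drop i s) >> = 0) ->
  L (seq_prism f g s) = 0.
Proof.
move=> L0; rewrite seq_prismE linear_sum big1 // => i _.
by rewrite linearZ /= L0 scaler0.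
Qed.

(** Every operator here has a rule for passing a cone, so the formula for [x s]
    reduces to the one for [s]; it holds for the empty sequence too, thanks to
    the augmentation. *)
Lemma chain_prism_homotopy f g c :
  chain_bdry (chain_prism f g c) + chain_prism f g (chain_bdry c) =
  chain_push g c - chain_push f c.
Proof.
apply: (@malg_linear_eq _ _ _
  ((chain_bdry \o chain_prism f g) \+ (chain_prism f g \o chain_bdry))
  (chain_push g \- chain_push f)) => s /=.
rewrite !chain_pushU chain_prismU chain_bdryU.
elim: s => [|x s IHs] /=; first by rewrite !linear0 addr0 subrr.
rewrite (linearB chain_bdry) (linearB (chain_prism f g)) /= chain_bdryU.
rewrite chain_prismU chain_prism_cone chain_bdry_cone.
move/(congr1 (cone (f x))): IHs.
rewrite linearD (linearB (cone (f x))) /= !coneU => IHs.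
have -> : chain_push g (seq_bdry K s) = seq_bdry K (map g s).
  by rewrite -!chain_bdryU chain_push_bdry chain_pushU.
rewrite (linearB (cone (f x))) /= coneU.
(* the induction hypothesis, coned off by [f x], expresses [f (x s)] *)
rewrite -[<< f x :: map f s >>](subKr << f x :: map g s >>) -IHs.
exact: prism_cancel.
Qed.

End SequenceMaps.

(** * Cliques and weak cliques *)

Section CliqueChains.
Variables (V : choiceType) (G : digraph V).

Definition weak_adj : rel V := fun x y => (x == y) || adj G x y.

(** The image of a directed clique under a vertex map that may collapse edges:
    a directed clique in which vertices may be repeated. *)
Definition weak_clique (s : seq V) : bool :=
  all (fun v => v \in verts G) s && pairwise weak_adj s.

Lemma directed_cliqueE n (s : n.-tuple V) :
  directed_clique G s = uniq s && weak_clique s.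
Proof.
apply/and3P/and3P => -[s_uniq s_verts].
  move=> /'forall_'forall_implyP adjs; split=> //.
  case E: (val s) => [//|x0 s']; rewrite -E.
  apply/(pairwiseP x0) => i j; rewrite !inE size_tuple => ils jls ij.
  have := adjs (Ordinal ils) (Ordinal jls) ij.
  by rewrite /weak_adj !(tnth_nth x0) /= => ->; rewrite orbT.
move=> adjs; split=> //; apply/'forall_'forall_implyP => i j ij.
have x0 := tnth s i.
move/(pairwiseP x0)/(_ i j): adjs; rewrite !inE size_tuple => /(_ _ _ ij).
rewrite !ltn_ord => /(_ isT isT); rewrite /weak_adj nth_uniq ?size_tuple //.
by rewrite (ltn_eqF ij) !(tnth_nth x0).
Qed.

(** If [x] comes back after a vertex [y], then there are weak edges from [x] to
    [y] and back, so [y = x]: the first copies of a repeated vertex are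
    neighbours. *)
Lemma weak_clique_repeat s :
  antisymmetric weak_adj -> weak_clique s -> ~~ uniq s ->
  exists a x b, s = a ++ x :: x :: b.
Proof.
move=> anti /andP[_]; elim: s => [|x s IHs] //= /andP[/allP xs s_adj].
rewrite negb_and negbK => /orP[]; last first.
  by move=> /(IHs s_adj)[a [y [b ->]]]; exists (x :: a), y, b.
case: s xs s_adj {IHs} => [//|y s] xs /= /andP[/allP ys _].
rewrite inE => /predU1P[->|x_s]; first by exists [::], y, s.
have -> : x = y by apply: anti; rewrite xs ?mem_head // ys.
by exists [::], y, s.
Qed.

Lemma weak_clique_face n (s : clique G n) : weak_clique (val s).
Proof. by have := valP s; rewrite directed_cliqueE => /andP[]. Qed.

Variable K : fieldType.

(** Reading a sequence in the complex of cliques of size [n] kills everything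
    that is not such a clique, in particular the degenerate sequences. *)
Definition seq_clique n (s : seq V) : {malg K[clique G n]} :=
  if insub s : option (n.-tuple V) is Some t then
    if insub t is Some c then << c >> else 0
  else 0.

Lemma seq_clique_val n (c : clique G n) : seq_clique n (val c) = << c >>.
Proof. by rewrite /seq_clique valK valK. Qed.

Lemma seq_clique_dup n s : ~~ uniq s -> seq_clique n s = 0.
Proof.
rewrite /seq_clique => s_dup; case: insubP => // t _ ts.
by case: insubP => // c; rewrite directed_cliqueE ts (negPf s_dup).
Qed.

Lemma seq_clique_size n s : size s != n -> seq_clique n s = 0.
Proof. by rewrite /seq_clique => s_size; rewrite insubN. Qed.

Lemma cliqueP n (s : seq V) : uniq s -> weak_clique s -> size s = n ->
  exists c : clique G n, s = val c.
Proof.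
move=> s_uniq s_weak sn.
have t_clique : directed_clique G (tcast sn (in_tuple s)).
  by rewrite directed_cliqueE val_tcast s_uniq.
by exists (Sub _ t_clique); rewrite /= val_tcast.
Qed.

Definition to_dFl n := lin_ext (seq_clique n.+1).
HB.instance Definition _ n := GRing.Linear.on (to_dFl n).

Lemma to_dFlU n s : to_dFl n << s >> = seq_clique n.+1 s.
Proof. exact: lin_extU. Qed.

Definition of_dFl n :=
  lin_ext (fun c : clique G n.+1 => << val (val c) >> : {malg K[seq V]}).
Arguments of_dFl : clear implicits.
HB.instance Definition _ n := GRing.Linear.on (of_dFl n).

Lemma of_dFlU n c : of_dFl n << c >> = << val (val c) >>.
Proof. exact: lin_extU. Qed.

Lemma of_dFlK n c : to_dFl n (of_dFl n c) = c.
Proof.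
apply: (@malg_linear_eq _ _ _ (to_dFl n \o of_dFl n) idfun) => {}c /=.
by rewrite of_dFlU to_dFlU seq_clique_val.
Qed.

Lemma val_del_vertex n (s : n.+1.-tuple V) i :
  val (del_vertex s i) = take i s ++ drop i.+1 s.
Proof.
have x0 := tnth s i; apply: (@eq_from_nth _ x0) => [|j].
  rewrite size_cat size_take size_drop !size_tuple ltn_ord; have := ltn_ord i; lia.
rewrite size_tuple => jn; rewrite -[LHS](tnth_nth x0 (del_vertex s i) (Ordinal jn)).
rewrite tnth_mktuple (tnth_nth x0) nth_cat size_take size_tuple ltn_ord /= /bump.
case: leqP => ij /=; last by rewrite nth_take.
by rewrite nth_drop; congr nth; lia.
Qed.

Lemma of_dFl_bdry n c :
  of_dFl n (flag_bdry G K n c) = chain_bdry (of_dFl n.+1 c).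
Proof.
apply: (@malg_linear_eq _ _ _ (of_dFl n \o flag_bdry G K n)
  (chain_bdry \o of_dFl n.+1)) => {}c /=.
rewrite flag_bdryU of_dFlU chain_bdryU seq_bdryE linear_sum size_tuple.
apply: eq_bigr => i _; rewrite linearZ /= of_dFlU.
congr (_ *: << _ >>); exact: val_del_vertex.
Qed.

(** On general sequences [to_dFl] does not commute with the boundary, because a
    sequence that is not a clique may have cliques among its faces.  On weak
    cliques this can only happen through a repeated vertex, where
    [seq_bdry_repeat] makes the faces cancel. *)
Lemma to_dFl_bdry n s : antisymmetric weak_adj -> weak_clique s ->
  to_dFl n (chain_bdry << s >>) = flag_bdry G K n (to_dFl n.+1 << s >>).
Proof.
move=> anti s_weak; rewrite chain_bdryU to_dFlU.
have [s_uniq|s_dup] := boolP (uniq s); last first.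
  rewrite seq_clique_dup // linear0.
  have [a [x [b ->]]] := weak_clique_repeat anti s_weak s_dup.
  by rewrite seq_bdry_repeat // => s' s'_dup; rewrite /= to_dFlU seq_clique_dup.
have [/eqP s_size|s_size] := boolP (size s == n.+2).
  have [c ->] := cliqueP s_uniq s_weak s_size.
  by rewrite seq_clique_val -[RHS]of_dFlK of_dFl_bdry of_dFlU chain_bdryU.
rewrite seq_clique_size // linear0 seq_bdryE linear_sum big1 // => i _.
rewrite linearZ /= to_dFlU seq_clique_size ?scaler0 //.
move: s_size; apply: contra => /eqP; rewrite size_cat size_take size_drop.
by have := ltn_ord i => /=; case: ifP; lia.
Qed.

End CliqueChains.
Arguments seq_clique {V} G K n s.
Arguments to_dFl {V} G K n _.
Arguments of_dFl {V} G K n _.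

(** * Maps induced by vertex maps that may collapse edges *)

(** The usual consequence of a chain homotopy.  Asking the difference to be a
    boundary only on cycles avoids a separate homotopy formula in degree [0]. *)
Lemma homology_map_eq (K : fieldType) (C D : chain_complex K)
    (f g : chain_map C D) :
  (forall k z, z \in cycles C k -> exists c, g k z - f k z = bdry D k c) ->
  forall k q, homology_map f (k := k) q = homology_map g q.
Proof.
move=> fg k q; rewrite -[q]quot_piK !homology_map_pi; apply/esym/quot_piP.
have [c fgc] := fg k _ (cycleP (quot_repr q)).
by apply/asboolP; exists c; rewrite linearB.
Qed.

Section InducedMap.
Variables (V W : choiceType) (G : digraph V) (H : digraph W).

Definition weak_hom (f : V -> W) : Prop :=
  {homo f : x / x \in verts G >-> x \in verts H} /\
  {homo f : x y / adj G x y >-> weak_adj H x y}.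

Lemma weak_hom_adj f : weak_hom f ->
  {homo f : x y / weak_adj G x y >-> weak_adj H x y}.
Proof.
by move=> [_ f_adj] x y /predU1P[->|/f_adj //]; rewrite /weak_adj eqxx.
Qed.

Lemma weak_clique_map f s :
  weak_hom f -> weak_clique G s -> weak_clique H (map f s).
Proof.
move=> fP /andP[s_verts s_adj]; apply/andP; split.
  by rewrite all_map; apply: sub_all s_verts; exact: fP.1.
by rewrite pairwise_map; apply: sub_pairwise s_adj => x y; exact: weak_hom_adj.
Qed.

(** The case [x = y] is included, so [f x] and [g x] are weakly adjacent. *)
Definition contiguous (f g : V -> W) : Prop :=
  {in verts G &, forall x y, weak_adj G x y -> weak_adj H (f x) (g y)}.

(** The terms of the prism of a clique are weak cliques, which lets the prism
    operator be carried over to the directed flag complex. *)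
Lemma weak_clique_prism f g i s : weak_hom f -> weak_hom g -> contiguous f g ->
  weak_clique G s -> weak_clique H (map f (take i.+1 s) ++ map g (drop i s)).
Proof.
move=> fP gP fg s_weak; have /andP[/allP s_verts s_adj] := s_weak.
have /andP[] := weak_clique_map fP s_weak; rewrite -[s in map f s](cat_take_drop i.+1).
rewrite map_cat all_cat pairwise_cat => /andP[f_verts _] /and3P[_ f_adj _].
have /andP[] := weak_clique_map gP s_weak; rewrite -[s in map g s](cat_take_drop i).
rewrite map_cat all_cat pairwise_cat => /andP[_ g_verts] /and3P[_ _ g_adj].
rewrite /weak_clique all_cat pairwise_cat f_verts g_verts f_adj g_adj !andbT /=.
apply/allrelP => _ _ /mapP[x xs ->] /mapP[y ys ->].
apply: fg; rewrite ?s_verts ?(mem_take xs) ?(mem_drop ys) //.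
case/(nthP x): xs => j; rewrite size_take => jlt <-.
case/(nthP x): ys => k; rewrite size_drop => klt <-.
rewrite nth_drop nth_take; last by move: jlt; case: ifP; lia.
have [->|jk] := eqVneq j (i + k)%N; first by rewrite /weak_adj eqxx.
move/(pairwiseP x): s_adj => /(_ j (i + k)%N); apply; rewrite ?inE;
  by move: jlt jk; case: ifP; lia.
Qed.

Variable K : fieldType.

Definition induced_fun (f : V -> W) n : {linear dFl G K n -> dFl H K n} :=
  to_dFl H K n \o (chain_push f \o of_dFl G K n).

Lemma induced_funU f n (c : clique G n.+1) :
  induced_fun f n << c >> = seq_clique H K n.+1 (map f (val (val c))).
Proof. by rewrite /= of_dFlU chain_pushU to_dFlU. Qed.

Hypothesis H_anti : antisymmetric (weak_adj H).

Section ChainMap.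
Variables (f : V -> W) (fP : weak_hom f).

Fact induced_funE n c :
  induced_fun f n (bdry (dFl G K) n c) = bdry (dFl H K) n (induced_fun f n.+1 c).
Proof.
apply: (@malg_linear_eq _ _ _ (induced_fun f n \o bdry (dFl G K) n)
  (bdry (dFl H K) n \o induced_fun f n.+1)) => {}c /=.
rewrite of_dFl_bdry chain_push_bdry of_dFlU chain_pushU.
by apply: to_dFl_bdry => //; apply: weak_clique_map => //; exact: weak_clique_face.
Qed.

Definition induced : chain_map (dFl G K) (dFl H K) := ChainMap induced_funE.

Lemma inducedU n (c : clique G n.+1) :
  induced n << c >> = seq_clique H K n.+1 (map f (val (val c))).
Proof. exact: induced_funU. Qed.

End ChainMap.

(** The prism operator is transported along [of_dFl] and [to_dFl].  In degree
    [0] the boundary of a vertex is the empty sequence instead of [0], but the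
    prism of the empty sequence vanishes. *)
Theorem contiguous_homology f g (fP : weak_hom f) (gP : weak_hom g) :
  contiguous f g -> forall k q,
  homology_map (induced fP) (k := k) q = homology_map (induced gP) q.
Proof.
move=> fg; apply: homology_map_eq => k z zZ.
exists (to_dFl H K k.+1 (chain_prism f g (of_dFl G K k z))) => /=.
have prism_bdry : flag_bdry H K k (to_dFl H K k.+1 (chain_prism f g (of_dFl G K k z)))
    = to_dFl H K k (chain_bdry (chain_prism f g (of_dFl G K k z))).
  (* [D], the defect of commutation, vanishes on every term of a prism *)
  pose D : {linear {malg K[seq W]} -> {malg K[clique H k.+1]}} :=
    (flag_bdry H K k \o to_dFl H K k.+1) \- (to_dFl H K k \o chain_bdry).
  have D0 s : weak_clique H s -> D << s >> = 0.
    by move=> s_weak; rewrite /D /= to_dFl_bdry // subrr.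
  apply/eqP; rewrite -subr_eq0; apply/eqP.
  change (D (chain_prism f g (of_dFl G K k z)) = 0); clearbody D.
  apply: (@malg_linear_eq _ _ _ (D \o (chain_prism f g \o of_dFl G K k)) \0) => c.
  rewrite /= of_dFlU chain_prismU; apply: linear_seq_prism0 => i; apply: D0.
  by apply: weak_clique_prism => //; exact: weak_clique_face.
rewrite prism_bdry -linearB -chain_prism_homotopy linearD /=.
suff -> : to_dFl H K k (chain_prism f g (chain_bdry (of_dFl G K k z))) = 0.
  by rewrite addr0.
case: k z zZ {prism_bdry} => [|k] z /= zZ; last first.
  by move: zZ; rewrite -of_dFl_bdry inE /= => /eqP ->; rewrite !linear0.
apply: (@malg_linear_eq _ _ _
  (to_dFl H K 0 \o (chain_prism f g \o (chain_bdry \o of_dFl G K 0))) \0) => c /=.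
rewrite of_dFlU chain_bdryU seq_bdryE size_tuple big_ord_recl big_ord0 addr0.
by case: (val c) => -[|x []] //= _; rewrite scale1r chain_prismU linear0.
Qed.

End InducedMap.

Lemma weak_hom_comp (U V W : choiceType) (G : digraph U) (H : digraph V)
    (I : digraph W) (f : U -> V) (g : V -> W) :
  weak_hom G H f -> weak_hom H I g -> weak_hom G I (g \o f).
Proof.
move=> fP gP; split=> [x /fP.1/gP.1 //|x y /fP.2 xy].
exact: (weak_hom_adj gP xy).
Qed.

(** A clique killed by [f] has a repeated vertex in its image, hence also in its
    image by [g \o f]: killing degenerate cliques early loses nothing. *)
Lemma induced_comp (U V W : choiceType) (G : digraph U) (H : digraph V)
    (I : digraph W) (K : fieldType) (H_anti : antisymmetric (weak_adj H))
    (I_anti : antisymmetric (weak_adj I))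
    (f : U -> V) (g : V -> W) (h : U -> W)
    (fP : weak_hom G H f) (gP : weak_hom H I g) (hP : weak_hom G I h) :
  g \o f =1 h -> forall k c,
  induced K I_anti gP k (induced K H_anti fP k c) = induced K I_anti hP k c.
Proof.
move=> gf k c.
apply: (@malg_linear_eq _ _ _ (induced K I_anti gP k \o induced K H_anti fP k)
  (induced K I_anti hP k)) => {}c.
change (induced K I_anti gP k (induced K H_anti fP k << c >>) =
  induced K I_anti hP k << c >>).
rewrite !inducedU -(eq_map gf) map_comp.
have [s_uniq|s_dup] := boolP (uniq (map f (val (val c)))); last first.
  rewrite !seq_clique_dup ?linear0 //.
  by apply: contra s_dup; exact: map_uniq.
have s_weak := weak_clique_map fP (weak_clique_face c).
have [d ->] := cliqueP s_uniq s_weak (etrans (size_map _ _) (size_tuple (val c))).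
by rewrite seq_clique_val inducedU.
Qed.

Lemma dFl_map_induced (V : choiceType) (G H : digraph V) (GH : subdigraph G H)
    (K : fieldType) (H_anti : antisymmetric (weak_adj H))
    (idP : weak_hom G H id) k c :
  dFl_map GH K k c = induced K H_anti idP k c.
Proof.
apply: (@malg_linear_eq _ _ _ (dFl_map GH K k) (induced K H_anti idP k)) => {}c.
by rewrite inducedU map_id [LHS]dFl_map_funU -seq_clique_val.
Qed.

Lemma homology_induced_comp (U V W : choiceType) (G : digraph U) (H : digraph V)
    (I : digraph W) (K : fieldType) (H_anti : antisymmetric (weak_adj H))
    (I_anti : antisymmetric (weak_adj I))
    (f : U -> V) (g : V -> W) (h : U -> W)
    (fP : weak_hom G H f) (gP : weak_hom H I g) (hP : weak_hom G I h) :
  g \o f =1 h -> forall k q,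
  homology_map (induced K I_anti gP) (k := k)
    (homology_map (induced K H_anti fP) q) =
  homology_map (induced K I_anti hP) q.
Proof. by move=> gf k; apply: homology_map_comp => {}k c; exact: induced_comp. Qed.

Lemma homology_dFl_map (V : choiceType) (G H : digraph V) (GH : subdigraph G H)
    (K : fieldType) (H_anti : antisymmetric (weak_adj H))
    (idP : weak_hom G H id) k q :
  homology_map (dFl_map GH K) (k := k) q =
  homology_map (induced K H_anti idP) q.
Proof.
apply: homology_map_eq => {q}k z _; exists 0.
by rewrite (dFl_map_induced _ H_anti idP) subrr linear0.
Qed.

Lemma homology_induced_square (U V V' W : choiceType) (G : digraph U)
    (H : digraph V) (H' : digraph V') (I : digraph W) (K : fieldType)
    (H_anti : antisymmetric (weak_adj H)) (H'_anti : antisymmetric (weak_adj H'))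
    (I_anti : antisymmetric (weak_adj I))
    (f : U -> V) (g : V -> W) (f' : U -> V') (g' : V' -> W)
    (fP : weak_hom G H f) (gP : weak_hom H I g)
    (f'P : weak_hom G H' f') (g'P : weak_hom H' I g') :
  g \o f =1 g' \o f' -> forall k q,
  homology_map (induced K I_anti gP) (k := k)
    (homology_map (induced K H_anti fP) q) =
  homology_map (induced K I_anti g'P) (homology_map (induced K H'_anti f'P) q).
Proof.
move=> gf k q; rewrite (homology_induced_comp _ _ _ _ (weak_hom_comp f'P g'P)) //.
by rewrite (homology_induced_comp _ _ _ _ (weak_hom_comp f'P g'P)).
Qed.

(** * Walks and the shortest-path filtration *)

Section Walks.
Variables (R : realType) (G : wdigraph R).
Implicit Types (x y z : vertex G) (l t : R).

(** A path of length exactly [l], where the empty path is allowed.  Exact lengths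
    matter for [subdivide_acyclic]: they turn acyclicity into the statement that
    closed walks have length [0]. *)
Inductive walk : vertex G -> vertex G -> R -> Prop :=
| walk_nil x : walk x x 0
| walk_cons e z l : walk (tgt e) z l -> walk (src e) z (weight e + l).

Lemma walk_ge0 x y l : walk x y l -> 0 <= l.
Proof. by elim=> // e z {}l _; apply: addr_ge0; exact/ltW/weight_gt0. Qed.

Lemma walk_eq0 x y l : walk x y l -> l <= 0 -> x = y.
Proof.
case=> // e z {}l /walk_ge0 l0; rewrite leNgt => /negP[].
exact/(ltr_wpDr l0)/weight_gt0.
Qed.

Lemma walk_cat x y z l l' : walk x y l -> walk y z l' -> walk x z (l + l').
Proof.
elim=> [? |e {}y {}l _ IHl /IHl yz]; first by rewrite add0r.
by rewrite -addrA; exact: walk_cons.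
Qed.

Lemma walk_edge (e : edge G) : walk (src e) (tgt e) (weight e).
Proof. by rewrite -[weight e]addr0; apply: walk_cons; exact: walk_nil. Qed.

Lemma path_walk x y e p : is_path x y e p -> walk x y (path_length e p).
Proof.
case=> + <- <-; elim: p e => [|f p IHp] e; rewrite /path_length big_cons.
  by move=> _; rewrite big_nil; apply: walk_cons; exact: walk_nil.
by move=> /= /andP[/eqP ef /IHp fp]; apply: walk_cons; rewrite ef.
Qed.

Lemma walk_path x y l : walk x y l ->
  (x = y /\ l = 0) \/ exists e p, is_path x y e p /\ path_length e p = l.
Proof.
elim=> [|e z {}l _ IHl]; first by left.
right; case: IHl => [[<- ->]|[f [p [[fp fe <-] <-]]]].
  by exists e, [::]; split; rewrite /path_length ?big_seq1 ?addr0.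
exists e, (f :: p); split; last by rewrite /path_length big_cons.
by split=> //=; rewrite -fe eqxx.
Qed.

Definition acyclic : Prop := forall x l, walk x x l -> l = 0.

Lemma dag_acyclic : is_dag G -> acyclic.
Proof.
move=> dag x l /walk_path[[]//|[e [p [xx _]]]].
have xP : has_path x x by exists e, p.
by case: (dag _ _ xP xP).
Qed.

Lemma SP_weak_adjP t x y : 0 <= t ->
  weak_adj (SP G t) x y <-> exists2 l, walk x y l & l <= t.
Proof.
move=> t0; split=> [/predU1P[<-|/andP[_ /asboolP[e [p [xy lt]]]]]|[l xy lt]].
- by exists 0 => //; exact: walk_nil.
- by exists (path_length e p) => //; exact: path_walk.
apply/orP; case: eqVneq => /= [|nxy]; first by left.
right; rewrite /SP_adj nxy; apply/asboolP.
have [[xy0 _]|[e [p [xyP ep]]]] := walk_path xy; first by rewrite xy0 eqxx in nxy.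
by exists e, p; rewrite ep.
Qed.

Lemma SP_weak_adj_anti t : acyclic -> antisymmetric (weak_adj (SP G t)).
Proof.
move=> acyc x y; case: (ltP t 0) => [t_lt0|t_ge0].
  case/andP=> /predU1P[//|/SP_adj_verts/andP[]].
  by rewrite [_ \in _]leNgt t_lt0.
case/andP=> /(SP_weak_adjP _ _ t_ge0)[l xy _] /(SP_weak_adjP _ _ t_ge0)[l' yx _].
apply: (walk_eq0 xy); rewrite -(acyc _ _ (walk_cat xy yx)) lerDl.
exact: walk_ge0 yx.
Qed.

End Walks.

(** The function [a] acts as a potential: its contributions telescope along the
    walk, so only its values at the two ends remain. *)
Lemma walk_map (R : realType) (G H : wdigraph R) (f : vertex G -> vertex H)
    (a : vertex G -> R) :
  (forall e : edge G,
     walk (f (src e)) (f (tgt e)) (weight e - a (src e) + a (tgt e))) ->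
  forall x y l, walk x y l -> walk (f x) (f y) (l - a x + a y).
Proof.
move=> f_edge x y l; elim=> [{}x|e {}y {}l _ IHl].
  by rewrite add0r addNr; exact: walk_nil.
have := walk_cat (f_edge e) IHl; congr walk; ring.
Qed.

(** * Interleavings from vertex maps *)

Section WalkInterleaving.
Variables (R : realType) (K : fieldType).

(** With [f = g] this says that [f] lengthens distances by at most [d].  With
    distinct maps it is what makes them contiguous after a shift by [d]. *)
Definition walks_within (G H : wdigraph R) (d : R) (f g : vertex G -> vertex H) :=
  forall x y l, walk x y l -> exists2 l', walk (f x) (g y) l' & l' <= l + d.

Lemma walks_within_contiguous (G H : wdigraph R) (d s t : R)
    (f g : vertex G -> vertex H) :
  0 <= d -> s + d <= t -> walks_within d f g -> contiguous (SP G s) (SP H t) f g.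
Proof.
move=> d0 st fg x y xs _ xy; have s0 : 0 <= s := xs.
have [l xyl ls] := (SP_weak_adjP x y s0).1 xy.
have [l' fgl ll'] := fg _ _ _ xyl.
apply/SP_weak_adjP; first by apply: le_trans st; exact: addr_ge0.
by exists l' => //; apply: le_trans ll' (le_trans _ st); rewrite lerD2r.
Qed.

Lemma walks_within_hom (G H : wdigraph R) (d s t : R) (f : vertex G -> vertex H) :
  0 <= d -> s + d <= t -> walks_within d f f -> weak_hom (SP G s) (SP H t) f.
Proof.
move=> d0 st ff; split=> [x s0|x y xy].
  by apply: le_trans st; exact: addr_ge0.
have /andP[xs ys] := adj_verts xy.
apply: (walks_within_contiguous d0 st ff xs ys).
by rewrite /weak_adj xy orbT.
Qed.

Lemma walks_within_id (G : wdigraph R) : walks_within 0 (@id (vertex G)) id.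
Proof. by move=> x y l xy; exists l; rewrite ?addr0. Qed.

Lemma SP_hom_id (G : wdigraph R) (s t : R) :
  s <= t -> weak_hom (SP G s) (SP G t) id.
Proof.
by move=> st; apply: (walks_within_hom (lexx 0)) (@walks_within_id G); rewrite addr0.
Qed.

Lemma HdFl_SP_mapE (G : wdigraph R) (G_acyc : acyclic G) (s t : R) (st : s <= t)
    k x :
  pers_map (HdFl_SP K G) st k x =
  homology_map (induced K (SP_weak_adj_anti G_acyc) (SP_hom_id G st)) x.
Proof. exact: homology_dFl_map. Qed.

Section ShiftHom.
Variables (G H : wdigraph R) (G_acyc : acyclic G) (H_acyc : acyclic H).
Variables (d : R) (d_ge0 : 0 <= d) (f : vertex G -> vertex H).
Hypothesis ff : walks_within d f f.

Definition shift_hom_fun (t : R) k :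
    {linear HdFl_SP K G t k -> shift (HdFl_SP K H) d t k} :=
  homology_map (induced K (SP_weak_adj_anti H_acyc)
    (walks_within_hom d_ge0 (lexx (t + d)) ff)) (k := k).

Fact shift_hom_natural (s t : R) (st : s <= t) k x :
  shift_hom_fun t k (pers_map (HdFl_SP K G) st k x) =
  pers_map (shift (HdFl_SP K H) d) st k (shift_hom_fun s k x).
Proof.
rewrite (HdFl_SP_mapE G_acyc) [RHS](HdFl_SP_mapE H_acyc).
exact: homology_induced_square.
Qed.

Definition shift_hom : pers_hom (HdFl_SP K G) (shift (HdFl_SP K H) d) :=
  PersHom shift_hom_natural.

End ShiftHom.

(** The composite is induced by [g \o f], which is contiguous to the identity
    after a shift by [2 d]. *)
Lemma shift_hom_comp (G H : wdigraph R) (G_acyc : acyclic G)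
    (H_acyc : acyclic H) (d : R) (d_ge0 : 0 <= d)
    (f : vertex G -> vertex H) (g : vertex H -> vertex G)
    (ff : walks_within d f f) (gg : walks_within d g g) :
  walks_within (d + d) id (g \o f) ->
  forall (t : R) (tt : t <= t + d + d) k (x : HdFl_SP K G t k),
  shift_hom H_acyc G_acyc d_ge0 gg (t + d) k (shift_hom G_acyc H_acyc d_ge0 ff t k x)
  = pers_map (HdFl_SP K G) tt k x.
Proof.
move=> gf t tt k x; rewrite (HdFl_SP_mapE G_acyc).
pose fP := walks_within_hom d_ge0 (lexx (t + d)) ff.
pose gP := walks_within_hom d_ge0 (lexx (t + d + d)) gg.
rewrite [LHS](homology_induced_comp _ _ _ _ (weak_hom_comp fP gP)) //.
apply/esym/contiguous_homology; apply: walks_within_contiguous gf.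
  exact: addr_ge0.
by rewrite addrA.
Qed.

Theorem walks_within_interleaved (G H : wdigraph R) (d : R)
    (f : vertex G -> vertex H) (g : vertex H -> vertex G) :
  acyclic G -> acyclic H -> 0 <= d ->
  walks_within d f f -> walks_within d g g ->
  walks_within (d + d) id (g \o f) -> walks_within (d + d) id (f \o g) ->
  interleaved (HdFl_SP K G) (HdFl_SP K H) d.
Proof.
move=> G_acyc H_acyc d_ge0 ff gg gf fg.
exists (shift_hom G_acyc H_acyc d_ge0 ff), (shift_hom H_acyc G_acyc d_ge0 gg).
by split=> t tt k x; exact: shift_hom_comp.
Qed.

End WalkInterleaving.

(** * Subdivisions *)

Section SubdividePoints.
Variables (R : realType) (G : wdigraph R) (F : set (edge G)) (S : subdivision F).
Implicit Types (e : F) (i : nat).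

(** The length of the part of [e] after its [i]-th point. *)
Definition tail_weight e i : R :=
  \sum_(j < (sd_dim S e).+1 | (i <= j)%N) sd_coord S e j * weight (val e).

Lemma sd_coord_gt0 e j : 0 < sd_coord S e j.
Proof. by have /andP[/forallP + _] := valP (tagged (S e)); exact. Qed.

Lemma tail_weight0 e : tail_weight e 0 = weight (val e).
Proof.
have /andP[_ /eqP sum1] := valP (tagged (S e)).
by rewrite /tail_weight -mulr_suml [X in X * _]sum1 mul1r.
Qed.

Lemma tail_weight_out e i : (sd_dim S e < i)%N -> tail_weight e i = 0.
Proof. by move=> di; apply: big1 => j; have := ltn_ord j; lia. Qed.

Lemma tail_weightS e (i : 'I_(sd_dim S e).+1) :
  tail_weight e i = sd_coord S e i * weight (val e) + tail_weight e i.+1.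
Proof.
rewrite /tail_weight (bigD1 i) //=; congr (_ + _); apply: eq_bigl => j.
by rewrite ltn_neqAle andbC eq_sym.
Qed.

Lemma tail_weight_ge0 e i : 0 <= tail_weight e i.
Proof.
by apply: sumr_ge0 => j _; rewrite mulr_ge0 // ltW ?sd_coord_gt0 ?weight_gt0.
Qed.

Lemma tail_weight_le e i : tail_weight e i <= weight (val e).
Proof.
rewrite -tail_weight0 /tail_weight [leRHS](bigID (fun j : 'I__ => (i <= j)%N)) /=.
rewrite lerDl sumr_ge0 // => j _.
by rewrite mulr_ge0 // ltW ?sd_coord_gt0 ?weight_gt0.
Qed.

Lemma sd_point_out e i : (sd_dim S e < i)%N -> sd_point S e i = inl (tgt (val e)).
Proof. by case: i => // i di; rewrite /sd_point insubF // ltnNge -ltnS di. Qed.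

Lemma walk_sd_point e i : (i <= (sd_dim S e).+1)%N ->
  @walk R (subdivide S) (sd_point S e i) (inl (tgt (val e))) (tail_weight e i).
Proof.
move E : ((sd_dim S e).+1 - i)%N => n; elim: n i E => [|n IHn] i E ie.
  by rewrite tail_weight_out ?sd_point_out; try lia; exact: walk_nil.
have id : (i < (sd_dim S e).+1)%N by lia.
rewrite (tail_weightS (Ordinal id)).
apply: (@walk_cons R (subdivide S) (inr (existT _ e (Ordinal id)))).
by apply: IHn => /=; lia.
Qed.

(** Retracting along the direction of the edges, a point can walk to its image,
    at the cost [residue]. *)
Definition proj (v : sd_vertex S) : vertex G :=
  match v with inl x => x | inr (existT e _) => tgt (val e) end.

Definition residue (v : sd_vertex S) : R :=
  match v with inl _ => 0 | inr (existT e k) => tail_weight e k.+1 end.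

Lemma proj_pointS e i : proj (sd_point S e i.+1) = tgt (val e).
Proof. by rewrite /sd_point; case: insubP. Qed.

Lemma residue_pointS e i : residue (sd_point S e i.+1) = tail_weight e i.+1.
Proof.
rewrite /sd_point; case: insubP => [k _ /= -> //|/=].
by rewrite -leqNgt => ?; rewrite tail_weight_out.
Qed.

Lemma residue_ge0 v : 0 <= residue v.
Proof. by case: v => [//|[e k]]; exact: tail_weight_ge0. Qed.

Lemma residue_le (m : R) v : 0 <= m -> (forall f : edge G, F f -> weight f <= m) ->
  residue v <= m.
Proof.
move=> m0 wm; case: v => [//|[e k]] /=.
by apply: le_trans (tail_weight_le e _) _; apply/wm/set_valP.
Qed.

Lemma walk_to_proj v : @walk R (subdivide S) v (inl (proj v)) (residue v).
Proof.
case: v => [x|[e k]] /=; first exact: walk_nil.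
have -> : inr (existT _ e k) = sd_point S e k.+1 by rewrite /sd_point valK.
by apply: walk_sd_point; rewrite ltnS ltnW.
Qed.

Lemma walk_inl x y l : walk x y l -> @walk R (subdivide S) (inl x) (inl y) l.
Proof.
move=> /(@walk_map _ _ (subdivide S) inl (fun=> 0)); rewrite subr0 addr0; apply.
move=> e; rewrite subr0 addr0; case: (pselect (F e)) => [Fe|nFe].
  have := @walk_sd_point (SigSub (mem_set Fe)) 0 isT.
  by rewrite tail_weight0.
have nFe' : (~` F)%classic e by [].
exact: (@walk_edge R (subdivide S) (inl (SigSub (mem_set nFe')))).
Qed.

(** The pieces of an edge [e] other than the first one are collapsed, and their
    weight is exactly what the residue loses; the first piece is sent to [e],
    and the residue gains what the piece lacks. *)
Lemma walk_proj v w l : @walk R (subdivide S) v w l ->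
  walk (proj v) (proj w) (l - residue v + residue w).
Proof.
apply: (@walk_map _ (subdivide S) G proj residue) => -[e|[e i]] /=.
  by rewrite subr0 addr0; exact: walk_edge.
rewrite residue_pointS proj_pointS.
case: i => -[|i] /= id.
  rewrite subr0 -(tail_weightS (Ordinal id)) tail_weight0; exact: walk_edge.
rewrite residue_pointS proj_pointS.
rewrite addrAC -(tail_weightS (Ordinal id)) subrr; exact: walk_nil.
Qed.

(** The correction terms of [walk_proj] cancel on a closed walk, so its length
    is that of a closed walk of [G]. *)
Lemma subdivide_acyclic : acyclic G -> acyclic (subdivide S).
Proof. by move=> acyc v l /walk_proj/acyc; rewrite addrNK. Qed.

End SubdividePoints.

Theorem proposition6p10 (R : realType) (K : fieldType) (G : wdigraph R)
    (F : set (edge G)) (S : subdivision F) (m : R) :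
  is_dag G -> is_max_weight F m ->
  (interleaving_distance (HdFl_SP K G) (HdFl_SP K (subdivide S)) <= m%:E)%E.
Proof.
move=> /dag_acyclic G_acyc Fm.
have [m0 wm] : 0 <= m /\ forall e, F e -> weight e <= m.
  case: Fm => [[-> ->]|[[e _ <-] wm]]; first by split.
  by split=> //; exact/ltW/weight_gt0.
have r_ge0 := residue_ge0 (S := S).
have r_le v := residue_le (S := S) v m0 wm.
apply: ereal_inf_lbound; exists m => //; split=> //.
apply: (@walks_within_interleaved _ _ _ (subdivide S) _ inl (@proj _ _ _ S)) => //.
- exact: subdivide_acyclic.
- by move=> x y l xy; exists l; [exact: walk_inl | rewrite lerDl].
- move=> v w l vw; exists (l - residue v + residue w); first exact: walk_proj.
  by rewrite lerD // gerBl.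
- by move=> x y l xy; exists l => //; rewrite lerDl addr_ge0.
move=> v w l vw; exists (l + residue w).
  by apply: walk_cat vw _; exact: walk_to_proj.
by rewrite lerD2l ler_wpDr.
Qed.
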